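(* Let $f:\mathbb{R}^n\to\mathbb{R}\cup\{+\infty\}$ and $g:\mathbb{R}^m\to\mathbb{R}\cup\{+\infty\}$ be proper lower semicontinuous convex functions, $A\in\mathbb{R}^{m\times n}$, and $L(x,\lambda)=f(x)-\lambda^TAx-g^*(\lambda)$. Let $P\in\mathbb{R}^{(n+m)\times(n+m)}$ be a (symmetric) positive semidefinite matrix, $z^0=(x^0,\lambda^0)\in\mathbb{R}^{n+m}$, and let $z^k=(x^k,\lambda^k)$, $k\ge1$, and vectors $F^{k+1}\in\mathbb{R}^{n+m}$, $k\ge0$, satisfy $$P(z^k-z^{k+1})=F^{k+1}\qquad\text{for all }k\ge0.$$ Suppose there exists a (symmetric) matrix $E\succeq0$ with $P\succeq E$ such that for all $k\ge0$ and all $z=(x,\lambda)\in\mathbb{R}^n\times\mathbb{R}^m$, $$L(x^{k+1},\lambda)-L(x,\lambda^{k+1})\le\langle F^{k+1},z^{k+1}-z\rangle+\tfrac12\|z^k-z^{k+1}\|_E^2 .$$ Set $\bar z^k=(\bar x^k,\bar\lambda^k)=\frac1k\sum_{i=1}^kz^i$. Then for every $k\ge1$ and every $z=(x,\lambda)\in\mathbb{R}^n\times\mathbb{R}^m$, $$L(\bar x^k,\lambda)-L(x,\bar\lambda^k)\le\frac{\|z-z^0\|_P^2}{2k}.$$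
   Context: $g^*(\lambda)=\max_y\{\lambda^Ty-g(y)\}$ (i.e. supremum) is the convex conjugate of $g$. For a positive semidefinite matrix $M$, $\|z\|_M^2=z^TMz$; $P\succeq E$ means $P-E$ is positive semidefinite. Convention for extended values: $L(x,\lambda)=+\infty$ if $f(x)=+\infty$, and $L(x,\lambda)=-\infty$ if $f(x)<+\infty$ and $g^*(\lambda)=+\infty$. ($F^{k+1}$ plays the role of an approximation to an element of the subdifferential $(\partial_xL,-\partial_\lambda L)$ at $z^{k+1}$.) *)

(* Defs.v *)
From HB Require Import structures.
From mathcomp Require Export all_boot all_order all_algebra.
From mathcomp Require Export all_classical all_reals all_analysis.

Set Implicit Arguments.
Unset Strict Implicit.
Unset Printing Implicit Defensive.

Import Order.TTheory GRing.Theory Num.Theory.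
Import numFieldNormedType.Exports.

Local Open Scope classical_set_scope.
Local Open Scope ring_scope.

Definition dotv (R : realType) (d : nat) (u v : 'cV[R]_d) : R :=
  (u^T *m v) 0 0.

Definition sqnorm_mx (R : realType) (d : nat) (M : 'M[R]_d) (z : 'cV[R]_d) : R :=
  dotv z (M *m z).

Definition psd (R : realType) (d : nat) (M : 'M[R]_d) : Prop :=
  M^T = M /\ forall z : 'cV[R]_d, 0 <= sqnorm_mx M z.

(* Not identically +oo and never -oo; thus a proper function h : R^d -> \bar R
   is an R `|` {+oo}-valued function. *)
Definition proper_fun (R : realType) (d : nat) (h : 'cV[R]_d -> \bar R) : Prop :=
  (exists x, h x < +oo)%E /\ (forall x, -oo < h x)%E.

(* Only used for functions that are never -oo, for which the right-hand side
   contains no oo - oo; the library convention 0 * +oo = 0 makes the endpoints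
   t = 0 and t = 1 harmless. *)
Definition convex_fun (R : realType) (d : nat) (h : 'cV[R]_d -> \bar R) : Prop :=
  forall (x y : 'cV[R]_d) (t : R), 0 <= t <= 1 ->
    (h (t *: x + (1 - t) *: y)%R <= t%:E * h x + (1 - t)%R%:E * h y)%E.

Definition convex_conjugate (R : realType) (d : nat) (g : 'cV[R]_d -> \bar R)
    (l : 'cV[R]_d) : \bar R :=
  ereal_sup [set ((dotv l y)%:E - g y)%E | y in [set: 'cV[R]_d]].

(* L(x, l) = f(x) - l^T A x - g^*(l), with the value +oo whenever f(x) = +oo,
   and -oo when f(x) < +oo and g^*(l) = +oo. *)
Definition lagrangian (R : realType) (n m : nat) (f : 'cV[R]_n -> \bar R)
    (g : 'cV[R]_m -> \bar R) (A : 'M[R]_(m, n))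
    (x : 'cV[R]_n) (l : 'cV[R]_m) : \bar R :=
  if f x == +oo%E then +oo%E
  else if convex_conjugate g l == +oo%E then -oo%E
  else (f x - (dotv l (A *m x))%:E - convex_conjugate g l)%E.

(* L(w_x, l) - L(x, w_l) for w = (w_x, w_l) and z = (x, l).  The subtraction is
   the dual one of the library, in which the indeterminate forms
   (+oo) - (+oo) and (-oo) - (-oo) equal +oo: an upper bound of the gap by a real
   number therefore asserts that the difference is meaningful. *)
Definition gap (R : realType) (n m : nat)
    (L : 'cV[R]_n -> 'cV[R]_m -> \bar R) (w z : 'cV[R]_(n + m)) : \bar R :=
  (L (usubmx w) (dsubmx z) - L (usubmx z) (dsubmx w))%dE.

Definition average (R : realType) (d : nat) (z : nat -> 'cV[R]_d) (k : nat) :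
    'cV[R]_d :=
  k%:R^-1 *: \sum_(1 <= i < k.+1) z i.

(* Main.v *)
Require Import Defs.
From mathcomp Require Import ring lra.

Set Implicit Arguments.
Unset Strict Implicit.

Import Order.TTheory GRing.Theory Num.Theory.
Import numFieldNormedType.Exports.
Local Open Scope ring_scope.

(** The one-step hypothesis, with [F k.+1] replaced by [P (z k - z k.+1)],
    bounds the gap at [z k.+1] by
    [<P (z k - z k.+1), z k.+1 - w> + |z k - z k.+1|_E^2 / 2].  The three-point
    identity for the seminorm of [P] turns the inner product into
    [(|w - z k|_P^2 - |w - z k.+1|_P^2 - |z k - z k.+1|_P^2) / 2], and
    [P - E >= 0] lets the last term absorb the [E]-term ([proximal_step_le]).
    What remains telescopes, so the sum of the first [k] gaps is at most
    [|w - z 0|_P^2 / 2].  Since the gap is convex in its first argument, [f] and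
    the conjugate of [g] being convex ([convex_conjugate_convex]) and the
    coupling bilinear, Jensen's inequality ([convex_fun_average]) passes from
    the average of the gaps to the gap of the average.

    The argument takes place in the reals because the one-step bound forces
    finiteness ([gap_bounded_fin]): tested against a point of the domain of [f],
    a real upper bound on the gap excludes an infinite value of [f] or of the
    conjugate at any iterate with positive index.  By Jensen the two functions
    are then finite at the average too, and a test point [w] with an infinite
    value only makes the gap equal to -oo. *)

(** * The semi-inner product of a positive semidefinite matrix *)

Section Dotv.
Variables (R : realType) (d : nat).
Implicit Types (u v w : 'cV[R]_d) (M : 'M[R]_d).

Lemma dotvDl u v w : dotv (u + v) w = dotv u w + dotv v w.
Proof. by rewrite /dotv linearD mulmxDl mxE. Qed.

Lemma dotvDr u v w : dotv w (u + v) = dotv w u + dotv w v.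
Proof. by rewrite /dotv mulmxDr mxE. Qed.

Lemma dotvZl a u v : dotv (a *: u) v = a * dotv u v.
Proof. by rewrite /dotv linearZ -scalemxAl mxE. Qed.

Lemma dotvZr a u v : dotv u (a *: v) = a * dotv u v.
Proof. by rewrite /dotv -scalemxAr mxE. Qed.

Lemma dotv0l v : dotv 0 v = 0.
Proof. by rewrite /dotv trmx0 mul0mx mxE. Qed.

Lemma dotvC u v : dotv u v = dotv v u.
Proof. by rewrite /dotv -[in LHS](trmxK v) -trmx_mul mxE. Qed.

Lemma dotv_mulmx M u v : dotv u (M *m v) = dotv (M^T *m u) v.
Proof. by rewrite /dotv trmx_mul trmxK mulmxA. Qed.

Lemma dotv_suml (I : Type) (r : seq I) (u : I -> 'cV[R]_d) v :
  dotv (\sum_(i <- r) u i) v = \sum_(i <- r) dotv (u i) v.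
Proof.
apply: (big_morph (fun x => dotv x v)) => [x y|]; last exact: dotv0l.
exact: dotvDl.
Qed.

Lemma dotv_sumr (I : Type) (r : seq I) (u : I -> 'cV[R]_d) v :
  dotv v (\sum_(i <- r) u i) = \sum_(i <- r) dotv v (u i).
Proof. by rewrite dotvC dotv_suml; apply: eq_bigr => i _; rewrite dotvC. Qed.

Lemma sqnorm_mxN M u : sqnorm_mx M (- u) = sqnorm_mx M u.
Proof.
by rewrite /sqnorm_mx -scaleN1r -scalemxAr dotvZl dotvZr mulrA mulrNN !mul1r.
Qed.

Lemma sqnorm_mxBl M N u :
  sqnorm_mx (M - N) u = sqnorm_mx M u - sqnorm_mx N u.
Proof. by rewrite /sqnorm_mx mulmxBl dotvDr -scaleN1r dotvZr mulN1r. Qed.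

Lemma sqnorm_mxD M u v : M^T = M ->
  sqnorm_mx M (u + v) = sqnorm_mx M u + 2 * dotv (M *m u) v + sqnorm_mx M v.
Proof.
move=> symM; rewrite /sqnorm_mx mulmxDr !dotvDl !dotvDr.
rewrite (dotv_mulmx M u v) symM (dotvC v (M *m u)); ring.
Qed.

(** The vectors [a - b] and [b - w] add up to [a - w]; expanding the squared
    seminorm of this sum exhibits the inner product on the left, with a surplus
    [|a - b|_P^2 / 2] that dominates the [E]-term. *)
Lemma proximal_step_le (P E : 'M[R]_d) (a b w : 'cV[R]_d) :
  psd P -> psd (P - E) ->
  dotv (P *m (a - b)) (b - w) + 2^-1 * sqnorm_mx E (a - b) <=
  2^-1 * (sqnorm_mx P (w - a) - sqnorm_mx P (w - b)).
Proof.
move=> [symP _] [_ /(_ (a - b))]; rewrite sqnorm_mxBl => leEP.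
rewrite -(opprB a w) -(opprB b w) !sqnorm_mxN.
have -> : a - w = (a - b) + (b - w) by rewrite addrA subrK.
rewrite (sqnorm_mxD (a - b) (b - w) symP); lra.
Qed.

End Dotv.

(** * Averages and convexity *)

Section Average.
Variables (R : realType).

Lemma average1 (d : nat) (z : nat -> 'cV[R]_d) : average z 1 = z 1%N.
Proof. by rewrite /average big_nat1 invr1 scale1r. Qed.

Lemma averageS (d : nat) (z : nat -> 'cV[R]_d) (k : nat) : (0 < k)%N ->
  average z k.+1 = k.+1%:R^-1 *: z k.+1 + (1 - k.+1%:R^-1) *: average z k.
Proof.
move=> k0; rewrite /average big_nat_recr //= scalerDr addrC scalerA.
congr (_ + _ *: _).
have k_neq0 : k%:R != 0 :> R by rewrite pnatr_eq0 -lt0n.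
have k1_neq0 : (1 + k%:R) != 0 :> R by rewrite nat1r pnatr_eq0.
by rewrite -nat1r; field; rewrite k_neq0 k1_neq0.
Qed.

Lemma usubmx_average (n m : nat) (z : nat -> 'cV[R]_(n + m)) (k : nat) :
  usubmx (average z k) = average (fun i => usubmx (z i)) k.
Proof. by rewrite /average linearZ linear_sum. Qed.

Lemma dsubmx_average (n m : nat) (z : nat -> 'cV[R]_(n + m)) (k : nat) :
  dsubmx (average z k) = average (fun i => dsubmx (z i)) k.
Proof. by rewrite /average linearZ linear_sum. Qed.

(** Jensen's inequality with equal weights, by induction on [k] through
    [averageS].  The sums start at index 1 because the starting point of an
    iteration need not lie in the domain of [h]. *)
Lemma convex_fun_average (d : nat) (h : 'cV[R]_d -> \bar R)
    (z : nat -> 'cV[R]_d) (a : nat -> R) (k : nat) :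
  convex_fun h -> (forall i, h (z i.+1) = (a i.+1)%:E) -> (0 < k)%N ->
  (h (average z k) <= (k%:R^-1 * \sum_(1 <= i < k.+1) a i)%:E)%E.
Proof.
move=> cvx ha; case: k => // k _; elim: k => [|k IHk].
  by rewrite average1 ha big_nat1 invr1 mul1r.
rewrite averageS //; set t := k.+2%:R^-1.
have t01 : 0 <= t <= 1.
  by rewrite /t invr_ge0 ler0n /= invf_le1 ?ltr0n // ler1n.
apply: (le_trans (cvx _ _ _ t01)).
rewrite ha (big_nat_recr k.+2) //=; set s := \sum_(_ <= _ < _) _ in IHk *.
have -> : t * (s + a k.+2) = t * a k.+2 + (1 - t) * (k.+1%:R^-1 * s).
  have k1_neq0 : (1 + k%:R) != 0 :> R by rewrite nat1r pnatr_eq0.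
  have k2_neq0 : (1 + (1 + k%:R)) != 0 :> R by rewrite !nat1r pnatr_eq0.
  by rewrite /t -!nat1r; field; rewrite k1_neq0 k2_neq0.
rewrite [leRHS]EFinD !EFinM leeD2l // lee_wpmul2l // lee_fin subr_ge0.
by case/andP: t01.
Qed.

End Average.

(** * The convex conjugate *)

Section Conjugate.
Variables (R : realType) (m : nat) (g : 'cV[R]_m -> \bar R).
Hypothesis g_proper : proper_fun g.

(** Any point [y] of the domain of [g] gives the real minorant
    [dotv l y - g y]. *)
Lemma convex_conjugate_gtNy (l : 'cV[R]_m) : (-oo < convex_conjugate g l)%E.
Proof.
case: g_proper => [[y gy_lty] /(_ y) gy_gtNy].
apply: (@lt_le_trans _ _ ((dotv l y)%:E - g y)%E); last first.
  by apply: ereal_sup_ubound; exists y.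
by case: (g y) gy_lty gy_gtNy => // r _ _; rewrite ltNyr.
Qed.

(** A supremum of functions that are affine in the dual variable. *)
Lemma convex_conjugate_convex : convex_fun (convex_conjugate g).
Proof.
move=> l l' t /andP[t0 t1]; apply: ub_ereal_sup => _ [y _ <-].
have minorant u : ((dotv u y)%:E - g y <= convex_conjugate g u)%E.
  by apply: ereal_sup_ubound; exists y.
have := minorant l; have := minorant l'; case: g_proper => _ /(_ y).
case: (g y) => // [r|] _ le' le; last by rewrite leNye.
have t1' : (0 <= (1 - t)%:E)%E by rewrite lee_fin subr_ge0.
have t0' : (0 <= t%:E)%E by rewrite lee_fin.
apply: le_trans (leeD (lee_wpmul2l t0' le) (lee_wpmul2l t1' le')).
rewrite -!EFinB -!EFinM -EFinD lee_fin dotvDl !dotvZl.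
lra.
Qed.

End Conjugate.

(** * The duality gap in extended values *)

Section Gap.
Variables (R : realType) (n m : nat).
Variables (f : 'cV[R]_n -> \bar R) (g : 'cV[R]_m -> \bar R) (A : 'M[R]_(m, n)).
Hypotheses (f_proper : proper_fun f) (g_proper : proper_fun g).
Local Notation L := (lagrangian f g A).

Lemma lagrangian_fin (x : 'cV[R]_n) (l : 'cV[R]_m) (a b : R) :
  f x = a%:E -> convex_conjugate g l = b%:E ->
  L x l = (a - dotv l (A *m x) - b)%:E.
Proof. by move=> fx gl; rewrite /lagrangian fx gl. Qed.

Lemma gap_fin (w z : 'cV[R]_(n + m)) (fw fz gw gz : R) :
  f (usubmx w) = fw%:E -> convex_conjugate g (dsubmx w) = gw%:E ->
  f (usubmx z) = fz%:E -> convex_conjugate g (dsubmx z) = gz%:E ->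
  gap L w z = ((fw - dotv (dsubmx z) (A *m usubmx w) - gz) -
               (fz - dotv (dsubmx w) (A *m usubmx z) - gw))%:E.
Proof.
by move=> ? ? ? ?; rewrite /gap (lagrangian_fin (a := fw) (b := gz)) //
  (lagrangian_fin (a := fz) (b := gw)).
Qed.

(** A test point whose primal part [x] lies in the domain of [f] suffices: an
    infinite [f] makes the minuend +oo, and otherwise an infinite conjugate
    makes the subtrahend -oo; both give the gap the value +oo. *)
Lemma gap_bounded_fin (w : 'cV[R]_(n + m)) (c : 'cV[R]_(n + m) -> R) :
  (forall z, (gap L w z <= (c z)%:E)%E) ->
  f (usubmx w) \is a fin_num /\ convex_conjugate g (dsubmx w) \is a fin_num.
Proof.
case: f_proper => [[x fx_lty] f_gtNy] /(_ (col_mx x 0)).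
have := convex_conjugate_gtNy g_proper (dsubmx w).
have := f_gtNy (usubmx w).
have fx_neqy : (f x == +oo%E) = false by apply/negbTE; rewrite -ltey.
rewrite /gap /lagrangian col_mxKu col_mxKd fx_neqy.
case: (f (usubmx w)) => // r _.
case: (convex_conjugate g (dsubmx w)) => // _ /=.
by case: ifP => _; [|case: (convex_conjugate g 0)].
Qed.

(** No indeterminate form arises: an infinite [f] at [z] makes the subtrahend
    +oo while the minuend stays below +oo, and otherwise an infinite conjugate
    makes the minuend -oo while the subtrahend stays real. *)
Lemma gap_eqNy (w z : 'cV[R]_(n + m)) (fw gw : R) :
  f (usubmx w) = fw%:E -> convex_conjugate g (dsubmx w) = gw%:E ->
  f (usubmx z) = +oo%E \/ convex_conjugate g (dsubmx z) = +oo%E ->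
  gap L w z = -oo%E.
Proof.
have [_ /(_ (usubmx z)) fz_gtNy] := f_proper.
have gz_gtNy := convex_conjugate_gtNy g_proper (dsubmx z).
move=> efw egw; rewrite /gap /lagrangian efw egw.
case: (f (usubmx z)) fz_gtNy => // [r|] _;
  case: (convex_conjugate g (dsubmx z)) gz_gtNy => //.
by move=> s _ [].
Qed.

End Gap.

(** * The ergodic rate *)

Theorem theorem2 (R : realType) (n m : nat)
    (f : 'cV[R]_n -> \bar R) (g : 'cV[R]_m -> \bar R) (A : 'M[R]_(m, n))
    (f_proper : proper_fun f) (f_lsc : lower_semicontinuous f) (f_cvx : convex_fun f)
    (g_proper : proper_fun g) (g_lsc : lower_semicontinuous g) (g_cvx : convex_fun g)
    (P : 'M[R]_(n + m)) (P_psd : psd P)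
    (z F : nat -> 'cV[R]_(n + m))
    (z_step : forall k : nat, P *m (z k - z k.+1) = F k.+1)
    (E_exists : exists E : 'M[R]_(n + m), [/\ psd E, psd (P - E) &
       forall (k : nat) (w : 'cV[R]_(n + m)),
         (gap (lagrangian f g A) (z k.+1) w <=
          (dotv (F k.+1) (z k.+1 - w)
           + 2^-1 * sqnorm_mx E (z k - z k.+1))%:E)%E]) :
  forall (k : nat) (w : 'cV[R]_(n + m)), (1 <= k)%N ->
    (gap (lagrangian f g A) (average z k) w <=
     (sqnorm_mx P (w - z 0%N) / (2 * k%:R))%:E)%E.
Proof.
case: E_exists => E [_ PE_psd step] k w k_gt0.
have fin i := gap_bounded_fin f_proper g_proper (step i).
pose a i := fine (f (usubmx (z i))).
pose b i := fine (convex_conjugate g (dsubmx (z i))).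
have fa i : f (usubmx (z i.+1)) = (a i.+1)%:E.
  by rewrite /a fineK //; case: (fin i).
have gb i : convex_conjugate g (dsubmx (z i.+1)) = (b i.+1)%:E.
  by rewrite /b fineK //; case: (fin i).
have jensen_f :=
  convex_fun_average (z := fun i => usubmx (z i)) f_cvx fa k_gt0.
have jensen_g := convex_fun_average (z := fun i => dsubmx (z i))
  (convex_conjugate_convex g_proper) gb k_gt0.
rewrite -usubmx_average in jensen_f; rewrite -dsubmx_average in jensen_g.
have [fbar Efbar] : exists r, f (usubmx (average z k)) = r%:E.
  case: f_proper => _ /(_ (usubmx (average z k))).
  by case: (f _) jensen_f => // r; exists r.
have [gbar Egbar] :
    exists r, convex_conjugate g (dsubmx (average z k)) = r%:E.
  have := convex_conjugate_gtNy g_proper (dsubmx (average z k)).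
  by case: (convex_conjugate _ _) jensen_g => // r; exists r.
have [_ /(_ (usubmx w)) fw_gtNy] := f_proper.
have gw_gtNy := convex_conjugate_gtNy g_proper (dsubmx w).
case Efw: (f (usubmx w)) fw_gtNy => [fw||] // _; last first.
  by rewrite (gap_eqNy A f_proper g_proper Efbar Egbar) ?leNye //; left.
case Egw: (convex_conjugate g (dsubmx w)) gw_gtNy => [gw||] // _; last first.
  by rewrite (gap_eqNy A f_proper g_proper Efbar Egbar) ?leNye //; right.
rewrite (gap_fin A Efbar Egbar Efw Egw) lee_fin.
rewrite Efbar lee_fin in jensen_f; rewrite Egbar lee_fin in jensen_g.
(* The real value of the gap at [z i], for positive [i]. *)
pose gap_at i := (a i - dotv (dsubmx w) (A *m usubmx (z i)) - gw) -
               (fw - dotv (dsubmx (z i)) (A *m usubmx w) - b i).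
have sum_gap : \sum_(1 <= i < k.+1) gap_at i <= 2^-1 * sqnorm_mx P (w - z 0%N).
  have le_tele : \sum_(1 <= i < k.+1) gap_at i <=
      2^-1 * (sqnorm_mx P (w - z 0%N) - sqnorm_mx P (w - z k)).
    have -> : sqnorm_mx P (w - z 0%N) - sqnorm_mx P (w - z k) =
        \sum_(0 <= i < k)
          (sqnorm_mx P (w - z i) - sqnorm_mx P (w - z i.+1)).
      rewrite -[LHS]opprB -(telescope_sumr (fun i => sqnorm_mx P (w - z i))) //.
      by rewrite -sumrN; apply: eq_bigr => i _; rewrite opprB.
    rewrite big_add1 /= mulr_sumr; apply: ler_sum => i _.
    apply: le_trans (proximal_step_le (z i) (z i.+1) w P_psd PE_psd).
    by have := step i w; rewrite (gap_fin A (fa i) (gb i) Efw Egw) lee_fin z_step.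
  apply: (le_trans le_tele); case: P_psd => _ /(_ (w - z k)); lra.
have k_neq0 : k%:R != 0 :> R by rewrite pnatr_eq0 -lt0n.
apply: (@le_trans _ _ (k%:R^-1 * \sum_(1 <= i < k.+1) gap_at i)); last first.
  have -> : sqnorm_mx P (w - z 0%N) / (2 * k%:R) =
      k%:R^-1 * (2^-1 * sqnorm_mx P (w - z 0%N)) by field.
  by apply: ler_wpM2l => //; rewrite invr_ge0 ler0n.
(* The coupling terms are linear in the iterate and commute with averaging. *)
have avg_gap : k%:R^-1 * \sum_(1 <= i < k.+1) gap_at i =
    (k%:R^-1 * (\sum_(1 <= i < k.+1) a i)
       - dotv (dsubmx w) (A *m usubmx (average z k)) - gw)
    - (fw - dotv (dsubmx (average z k)) (A *m usubmx w)
       - k%:R^-1 * (\sum_(1 <= i < k.+1) b i)).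
  have avg_const c : k%:R^-1 * \sum_(1 <= i < k.+1) c = c :> R.
    by rewrite sumr_const_nat subn1 -[c *+ _]mulr_natl mulKf.
  rewrite usubmx_average dsubmx_average /average -scalemxAr dotvZl dotvZr.
  rewrite mulmx_sumr dotv_sumr dotv_suml /gap_at !sumrB.
  by rewrite !mulrBr !avg_const.
by rewrite avg_gap; lra.
Qed.
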